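(* Any countable anti-rectangular Abel Grassmann band $K$ is isomorphic to the groupoid $H=\bigcup_{n=1}^{\infty}G_n$ with product $*$ defined in the context.
   Context: A groupoid is a nonempty set with a binary operation, written as juxtaposition. An anti-rectangular Abel Grassmann band (the class of these is denoted $\mathbf{ARAGB}$) is a groupoid satisfying $(xy)z=(zy)x$, $x = xx$ and $(xy)x=y$ for all elements $x,y,z$. Countable means of cardinality $\aleph_0$. $G$ is the four-element groupoid $\{a,b,ab,ba\}$ with Cayley table (entry = row element times column element; columns in the order $a,b,ab,ba$): row $a$: $a,\ ab,\ ba,\ b$; row $b$: $ba,\ b,\ a,\ ab$; row $ab$: $b,\ ba,\ ab,\ a$; row $ba$: $ab,\ a,\ b,\ ba$. It lies in $\mathbf{ARAGB}$. Formal extension $H^x$: let $H\in\mathbf{ARAGB}$ contain $G$ as a subgroupoid and let $x\notin H$. Let $A=\{xh\}_{h\in H}$, $B=\{hx\}_{h\in H}$, $C=\{(ax)h\}_{h\in H}$ be sets of formal symbols, each indexed injectively by $h\in H$, pairwise disjoint and disjoint from $H$. Put $H^x=H\cup A\cup B\cup C$, with $H$ keeping its own product and, for $h,k\in H$ (all products of elements of $H$ on the right-hand sides computed in $H$): - $h\cdot(xk)=(ax)[(ka)h]$, $\ h\cdot(kx)=x(kh)$, $\ h\cdot((ax)k)=[(hk)(ah)]x$; - $(xh)\cdot k=(kh)x$, $\ (xh)\cdot(xk)=x(hk)$, $\ (xh)\cdot(kx)=(ax)[k(ah)]$, $\ (xh)\cdot((ax)k)=a(hk)$; - $(hx)\cdot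 k=(ax)[(ha)(kh)]$, $\ (hx)\cdot(xk)=kh$, $\ (hx)\cdot(kx)=(hk)x$, $\ (hx)\cdot((ax)k)=x[(ah)k]$; - $((ax)h)\cdot k=x[h(ka)]$, $\ ((ax)h)\cdot(xk)=[(hk)a]x$, $\ ((ax)h)\cdot(kx)=(ah)(ka)$, $\ ((ax)h)\cdot((ax)k)=(ax)(hk)$. Define $G_1=G$ and inductively $G_n=G_{n-1}^{x_{n-1}}$ for $n\ge 2$, where $x_{n-1}\notin G_{n-1}$; thus $G_1\subset G_2\subset\cdots$, each a subgroupoid of the next. Let $H=\bigcup_{n=1}^\infty G_n$. For $u\in H$ let $n_u$ be the least $n\ge 1$ with $u\in G_n$, and define $u*v$ to be the product of $u$ and $v$ in $G_{\max\{n_u,n_v\}}$. *)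

(* Defs.v *)
From HB Require Import structures.
From mathcomp Require Import all_boot.
From mathcomp Require Import boolp classical_sets functions cardinality.

Set Implicit Arguments.
Unset Strict Implicit.
Unset Printing Implicit Defensive.

Local Open Scope classical_set_scope.

(* The groupoids (sets with a binary operation) are the [magmaType]s.  A
   groupoid is nonempty by convention; here this follows from countability. *)
Definition ARAGB (K : magmaType) : Prop :=
  [/\ forall x y z : K, ((x * y) * z)%g = ((z * y) * x)%g,
      forall x : K, x = (x * x)%g
    & forall x y : K, ((x * y) * x)%g = y].

Inductive G4 : Set := ga | gb | gab | gba.

Definition G4_mul (u v : G4) : G4 :=
  match u, v with
  | ga,  ga => ga  | ga,  gb => gab | ga,  gab => gba | ga,  gba => gb
  | gb,  ga => gba | gb,  gb => gb  | gb,  gab => ga  | gb,  gba => gab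
  | gab, ga => gb  | gab, gb => gba | gab, gab => gab | gab, gba => ga
  | gba, ga => gab | gba, gb => ga  | gba, gab => gb  | gba, gba => gba
  end.

HB.instance Definition _ := hasMul.Build G4 G4_mul.

(* All the sets G_n are realised as subsets of one type of formal symbols, so
   that the inclusions between them and their union are literal.  The adjoined
   letters x are numbered by [nat]. *)
Inductive symb : Set :=
  | base of G4
  | xl of nat & symb      (* [xl x h] is the symbol x h *)
  | xr of nat & symb      (* [xr x h] is the symbol h x *)
  | axl of nat & symb.    (* [axl x h] is the symbol (a x) h *)

Section FormalExtension.

Variables (H : set symb) (m : symb -> symb -> symb) (x : nat).

Definition ext : set symb :=
  H `|` [set xl x h | h in H] `|` [set xr x h | h in H]
    `|` [set axl x h | h in H].

Inductive piece : Set := inH of symb | inA of symb | inB of symb | inC of symb.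

(* Which of the four pieces H, A, B, C of [ext] an element lies in, and its
   index, when no symbol built with the letter [x] belongs to [H]. *)
Definition piece_of (u : symb) : piece :=
  match u with
  | xl y h => if y == x then inA h else inH u
  | xr y h => if y == x then inB h else inH u
  | axl y h => if y == x then inC h else inH u
  | base _ => inH u
  end.

Local Notation a := (base ga).

Definition ext_mul (u v : symb) : symb :=
  match piece_of u, piece_of v with
  | inH h, inH k => m h k
  | inH h, inA k => axl x (m (m k a) h)
  | inH h, inB k => xl x (m k h)
  | inH h, inC k => xr x (m (m h k) (m a h))
  | inA h, inH k => xr x (m k h)
  | inA h, inA k => xl x (m h k)
  | inA h, inB k => axl x (m k (m a h))
  | inA h, inC k => m a (m h k)
  | inB h, inH k => axl x (m (m h a) (m k h))
  | inB h, inA k => m k h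
  | inB h, inB k => xr x (m h k)
  | inB h, inC k => xl x (m (m a h) k)
  | inC h, inH k => xl x (m h (m k a))
  | inC h, inA k => xr x (m (m h k) a)
  | inC h, inB k => m (m a h) (m k a)
  | inC h, inC k => axl x (m h k)
  end.

End FormalExtension.

(* [G_ n] with product [Gmul n] is the (n+1)-st groupoid G_{n+1} of the
   construction, and G_{n+2} is obtained from it with the letter number n.
   Outside of [G_ n] the values of [Gmul n] are irrelevant. *)
Fixpoint G_ (n : nat) : set symb :=
  if n is n'.+1 then ext (G_ n') n' else range base.

Fixpoint Gmul (n : nat) : symb -> symb -> symb :=
  if n is n'.+1 then ext_mul (Gmul n') n' else
  fun u v => match u, v with
             | base g, base h => base (g * h)%g
             | _, _ => u
             end.

Definition H : Type := set_type (\bigcup_n G_ n).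

Lemma H_ex (u : H) : exists n, `[< G_ n (val u) >].
Proof. by case: u => u /= /set_mem [n _ Gu]; exists n; apply/asboolP. Qed.

(* n_u - 1, in the numbering G_1, G_2, ... of the chain. *)
Definition level (u : H) : nat := ex_minn (H_ex u).

Lemma G_fresh n x u : G_ n u -> n <= x -> piece_of x u = inH u.
Proof.
elim: n u => [|n IHn] u /=; first by case=> g _ <-.
have nx : n < x -> (n == x) = false by move=> /ltn_eqF.
case=> [[[Gu|[h _ <-]]|[h _ <-]]|[h _ <-]] ltnx; rewrite /= ?nx//.
by apply: IHn => //; exact: ltnW.
Qed.

Lemma G_le m n : m <= n -> G_ m `<=` G_ n.
Proof.
elim: n => [|n IHn]; first by rewrite leqn0 => /eqP ->.
rewrite leq_eqVlt ltnS => /orP[/eqP-> // | /IHn le_mn u /le_mn Gu].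
by left; left; left.
Qed.

Lemma Gmul_closed n u v : G_ n u -> G_ n v -> G_ n (Gmul n u v).
Proof.
elim: n u v => [|n IHn] u v.
  by move=> [g _ <-] [h _ <-]; exists (g * h)%g.
have Ga : G_ n (base ga) by apply: (G_le (leq0n n)); exists ga.
have toH h : G_ n h -> G_ n.+1 h by move=> ?; left; left; left.
have toA h : G_ n h -> G_ n.+1 (xl n h) by move=> ?; left; left; right; exists h.
have toB h : G_ n h -> G_ n.+1 (xr n h) by move=> ?; left; right; exists h.
have toC h : G_ n h -> G_ n.+1 (axl n h) by move=> ?; right; exists h.
have pieceP w : G_ n.+1 w ->
    match piece_of n w with inH h | inA h | inB h | inC h => G_ n h end.
  case=> [[[Gw|[h Gh <-]]|[h Gh <-]]|[h Gh <-]] /=; rewrite ?eqxx//.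
  by rewrite (G_fresh Gw).
move=> /pieceP Gu /pieceP Gv; rewrite [Gmul _]/= /ext_mul.
case: (piece_of n u) Gu => h Gh; case: (piece_of n v) Gv => k Gk;
  by first [apply: toA | apply: toB | apply: toC | apply: toH]; auto 6.
Qed.

Lemma G_level (u : H) n : level u <= n -> G_ n (val u).
Proof.
rewrite /level; case: ex_minnP => k /asboolP Gk _ le_kn; exact: G_le le_kn _ Gk.
Qed.

Lemma star_subproof (u v : H) :
  Gmul (maxn (level u) (level v)) (val u) (val v) \in \bigcup_n G_ n.
Proof.
apply/mem_set; exists (maxn (level u) (level v)) => //.
by apply: Gmul_closed; apply: G_level; [exact: leq_maxl | exact: leq_maxr].
Qed.

Definition star (u v : H) : H :=
  exist (fun w => w \in \bigcup_n G_ n) _ (star_subproof u v).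

HB.instance Definition _ := hasMul.Build H star.

(* Main.v *)
Require Import Defs.
From HB Require Import structures.
From mathcomp Require Import all_boot.
From mathcomp Require Import boolp classical_sets functions cardinality.

(** An anti-rectangular AG-band is an affine space over the field with four
    elements in disguise: if [w] is a primitive element of that field, the
    product is [x * y = w x + w^2 y].  The four points [a], [b], [ab], [ba]
    form an affine line, and passing from [H] to [H^x] adjoins one affinely
    independent point: the affine hull of [H] and [x] is the disjoint union of
    [H], [x H], [H x] and [(a x) H].  An affine space is determined by its
    dimension, and all the countably infinite ones have the same dimension, so
    [K] must be the union of the chain [G_n].

    The proof performs the corresponding choice of an affine basis inside [K]
    without introducing the field.  Every choice of [p], [q] in [K] for the
    images of [a], [b], and of a sequence [c] of images of the letters, extends
    to an evaluation [ev] of formal symbols in [K].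
    - [ev] is multiplicative on each [G_n] ([ev_mul]): the rules defining
      a formal extension are identities valid in every anti-rectangular AG-band.
    - [ev] is injective ([ev_inj]) as soon as [p] and [q] differ and each letter
      is sent outside of the image of the preceding stage: if two of the four
      pieces met, or if an index was not determined, one could solve for the
      letter and find it in that image.
    - [ev] is surjective for a suitable [c] ([exhausting_letters]): enumerate
      [K], and send the [n]-th letter to the [n]-th element of [K], unless the
      image of the preceding stage already contains it.  That image is finite
      while [K] is not, so in that case another new element is available.
    The isomorphism is the inverse of [ev]. *)

Local Open Scope classical_set_scope.
Local Open Scope card_scope.

(** * The stages of the chain *)

Lemma G_finite n : finite_set (G_ n).
Proof.
elim: n => [|n IHn] /=.
  apply: (@sub_finite_set _ _ [set base ga; base gb; base gab; base gba]).
    by move=> _ [[] _ <-] /=; tauto.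
  by rewrite !finite_setU; do !split; exact: finite_set1.
by rewrite /ext !finite_setU; do !split => //; exact: finite_image.
Qed.

Lemma piece_ofP {n u} : G_ n.+1 u ->
  match piece_of n u with
  | inH h => G_ n h /\ u = h
  | inA h => G_ n h /\ u = xl n h
  | inB h => G_ n h /\ u = xr n h
  | inC h => G_ n h /\ u = axl n h
  end.
Proof.
case=> [[[Gu|[h Gh <-]]|[h Gh <-]]|[h Gh <-]] /=; rewrite ?eqxx//.
by rewrite (G_fresh Gu).
Qed.

(** * Identities of anti-rectangular AG-bands *)

Section Band.

Context {K : magmaType} (hK : ARAGB K).
Implicit Types x y z t h k p : K.
Local Open Scope group_scope.

Lemma invertl x y z : x * y * z = z * y * x.
Proof. by case: hK. Qed.

Lemma idem x : x * x = x.
Proof. by case: hK => _ /(_ x). Qed.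

Lemma mulKr x y : x * y * x = y.
Proof. by case: hK. Qed.

Lemma medial x y z t : x * y * (z * t) = x * z * (y * t).
Proof. by rewrite invertl (invertl z) [RHS]invertl. Qed.

Lemma mulKl x y : x * (y * x) = y.
Proof. by rewrite -{1}(idem x) medial idem mulKr. Qed.

Lemma mulrr x y : x * y * y = y * x.
Proof. by rewrite invertl idem. Qed.

Lemma mulll x y : x * (x * y) = y * x.
Proof. by rewrite -mulrr mulKr. Qed.

(** The mirror image of the left invertive law.  In a quasigroup with
    [x * y * x = y] one may permute cyclically the three members of an equation
    [u * x = v], and this turns one law into the other. *)
Lemma invertr x y z : x * (y * z) = z * (y * x).
Proof.
set u := x * (y * z).
have ux : u * x = y * z by rewrite mulKr.
have -> : z = y * x * u by rewrite invertl ux mulKr.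
by rewrite mulKr.
Qed.

Lemma distl x y z : x * (y * z) = x * y * (x * z).
Proof. by rewrite -{1}(idem x) medial. Qed.

(** In affine terms both sides are [w^2 h + w k]: the two occurrences of [x] have
    the same coefficient [1], and they cancel in characteristic two. *)
Lemma mul_cancel_mid h x k : h * x * (x * k) = k * h.
Proof. by rewrite invertr mulKl. Qed.

(** In affine terms both sides are [x + h + k]; on the left, [p] has the
    coefficient [w^2 + w^2 = 0]. *)
Lemma sum3E p x h k : p * x * (k * (p * h)) = x * h * (k * x).
Proof.
set u := RHS.
have <- : u * (p * x) = k * (p * h).
  by rewrite /u medial (invertl x) mulrr mul_cancel_mid.
by rewrite mulKl.
Qed.

Lemma sum3C x h k : x * h * (k * x) = h * x * (k * h).
Proof. by rewrite -(sum3E x) invertr sum3E. Qed.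

(** ** Solving for an adjoined point *)

(** The next six lemmas treat the six pairs of distinct pieces of a formal
    extension with base [H], adjoined point [x] and [p] in [H]: a common value of
    two pieces would express [x] through elements of [H]. *)
Lemma solve_H_xl x h k : h = x * k -> x = k * h.
Proof. by move=> ->; rewrite mulKl. Qed.

Lemma solve_H_xr x h k : h = k * x -> x = h * k.
Proof. by move=> ->; rewrite mulKr. Qed.

Lemma solve_H_axl p x h k : h = p * x * k -> x = k * h * p.
Proof. by move=> ->; rewrite mulKl mulKr. Qed.

Lemma solve_xl_xr x h k : x * h = k * x -> x = k * h.
Proof. by move=> e; rewrite -(mulKr x h) e mulrr mulKl. Qed.

Lemma solve_xl_axl p x h k : x * h = p * x * k -> x = k * p * h * p.
Proof.
rewrite invertl => e.
have -> : h = p * x * (k * p).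
  by rewrite -(mulKr x h) e invertl sum3C invertl.
by rewrite mulKl mulKr.
Qed.

(** Here [h * x = k * x * p] gives [x = x * (p * (h * k))], and an element fixed
    by a right multiplication is the multiplier. *)
Lemma solve_xr_axl p x h k : h * x = p * x * k -> x = p * (h * k).
Proof.
rewrite (invertl p) => e; set y := p * (h * k).
have xy : x = x * y.
  by rewrite -{1}(mulKr h x) e invertl medial invertr.
by rewrite -(mulKr x y) -xy idem.
Qed.

(** * Evaluating formal symbols *)

Variables (p q : K) (c : nat -> K).

Fixpoint ev (u : symb) : K :=
  match u with
  | base ga => p
  | base gb => q
  | base gab => p * q
  | base gba => q * p
  | xl n h => c n * ev h
  | xr n h => ev h * c n
  | axl n h => p * c n * ev h
  end.

(** Each formula defining a product of the extension is the same affine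
    combination of the letter, the indices and [a] as the product that it
    defines, so it becomes an identity of [K] once [a] is read as [p].  The base
    case compares the Cayley table of [G4] with the line through [p] and [q]. *)
Lemma ev_mul n u v : G_ n u -> G_ n v -> ev (Gmul n u v) = ev u * ev v.
Proof.
elim: n u v => [|n IHn] u v.
  move=> [g _ <-] [h _ <-]; case: g; case: h => /=;
  by rewrite ?mul_cancel_mid ?mulKl ?mulKr ?mulll ?mulrr ?idem.
have Ga : G_ n (base ga) by apply: (G_le (leq0n n)); exists ga.
move=> /piece_ofP Gu /piece_ofP Gv; move: Gu Gv; rewrite [Gmul _]/= /ext_mul.
case: (piece_of n u) => i [Gi ->]; case: (piece_of n v) => j [Gj ->];
  rewrite /= ?IHn; try by repeat first [assumption | apply: Gmul_closed].
(* From here on, one goal for each rule, in the order of the pieces H, A, B, C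
   of the left factor, then of the right factor. *)
all: rewrite /=; move: (c n) (ev i) (ev j) => x h k.
- by rewrite medial mulKl [RHS]invertr.
- exact: invertr.
- by rewrite invertl [RHS]distl (invertr h).
- exact: invertl.
- exact: distl.
- exact: sum3E.
- by rewrite medial mulKl.
- by rewrite medial mulKl (invertr x) mulll invertl.
- by rewrite mul_cancel_mid.
- by rewrite [RHS]medial idem.
- by rewrite [RHS]medial (invertr h) -distl.
- by rewrite (invertr h) invertr -invertl.
- by rewrite invertl (invertl p) [RHS]medial mulrr medial.
- by rewrite [RHS]invertr [RHS]distl (invertr x) mulrr (invertr h) sum3E medial
             sum3C medial.
- by rewrite [RHS]medial idem.
Qed.

Lemma ev_image_mul n y z :
  (ev @` G_ n) y -> (ev @` G_ n) z -> (ev @` G_ n) (y * z).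
Proof.
move=> [u Gu <-] [v Gv <-].
by exists (Gmul n u v); [exact: Gmul_closed | exact: ev_mul].
Qed.

(** Each of the four pieces is indexed injectively because translations are
    cancellable, and a coincidence between two pieces is refuted by solving for
    the letter, which would then lie in the subgroupoid [ev @` G_ n]. *)
Lemma ev_inj n u v : p <> q -> (forall n, ~ (ev @` G_ n) (c n)) ->
  G_ n u -> G_ n v -> ev u = ev v -> u = v.
Proof.
move=> pq newc; elim: n u v => [|n IHn] u v.
  have e1 : p <> p * q by move=> e; apply: pq; rewrite -(mulKr p q) -e idem.
  have e2 : p <> q * p by move=> e; apply: pq; rewrite -(mulKl p q) -e idem.
  have e3 : q <> p * q by move=> e; apply: pq; rewrite -(mulKl q p) -e idem.
  have e4 : q <> q * p by move=> e; apply: pq; rewrite -(mulKr q p) -e idem.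
  have e5 : p * q <> q * p.
    by move=> e; apply: e4; rewrite -[LHS](mulKr p) e mulrr -e.
  by move=> [g _ <-] [h _ <-]; case: g; case: h => //= e; exfalso; auto.
have Sp : (ev @` G_ n) p.
  by exists (base ga) => //; apply: (G_le (leq0n n)); exists ga.
have SM := @ev_image_mul n.
have new z : c n = z -> ~ (ev @` G_ n) z by move=> <-; exact: newc.
move=> /piece_ofP + /piece_ofP.
case: (piece_of n u) => h [Gh ->]; case: (piece_of n v) => k [Gk ->] /= e.
all: have Sh : (ev @` G_ n) (ev h) by exists h.
all: have Sk : (ev @` G_ n) (ev k) by exists k.
- exact: IHn.
- by case: (new _ (solve_H_xl _ _ _ e)); auto.
- by case: (new _ (solve_H_xr _ _ _ e)); auto.
- by case: (new _ (solve_H_axl _ _ _ _ e)); auto.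
- by case: (new _ (solve_H_xl _ _ _ (esym e))); auto.
- by congr xl; apply: IHn => //; rewrite -(mulKr (c n) (ev h)) e mulKr.
- by case: (new _ (solve_xl_xr _ _ _ e)); auto.
- by case: (new _ (solve_xl_axl _ _ _ _ e)); auto.
- by case: (new _ (solve_H_xr _ _ _ (esym e))); auto.
- by case: (new _ (solve_xl_xr _ _ _ (esym e))); auto.
- by congr xr; apply: IHn => //; rewrite -(mulKl (c n) (ev h)) e mulKl.
- by case: (new _ (solve_xr_axl _ _ _ _ e)); auto.
- by case: (new _ (solve_H_axl _ _ _ _ (esym e))); auto.
- by case: (new _ (solve_xl_axl _ _ _ _ (esym e))); auto.
- by case: (new _ (solve_xr_axl _ _ _ _ (esym e))); auto.
- by congr axl; apply: IHn => //; rewrite -(mulKr (p * c n) (ev h)) e mulKr.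
Qed.

End Band.

(** * Choosing the letters *)

Section Letters.
Context {K : magmaType} (p q : K).
Local Open Scope group_scope.

Lemma ev_image_ext (c : nat -> K) n :
  ev p q c @` G_ n.+1 =
  let S := ev p q c @` G_ n in
  S `|` [set c n * z | z in S] `|` [set z * c n | z in S]
    `|` [set p * c n * z | z in S].
Proof. by rewrite /= /ext !image_setU !image_comp. Qed.

(** The image of the [n]-th stage depends on the letters before the [n]-th only.
    The sets [T n] are these images, built along with the letters so that the
    choice of the [n]-th letter can refer to them. *)
Lemma exhausting_letters (g : nat -> K) : infinite_set [set: K] ->
  exists c : nat -> K, forall n,
    ~ (ev p q c @` G_ n) (c n) /\ ((ev p q c @` G_ n) (g n) \/ c n = g n).
Proof.
move=> Kinf.
have ex_letter (nS : nat * set K) : exists x, finite_set nS.2 ->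
    ~ nS.2 x /\ (nS.2 (g nS.1) \/ x = g nS.1).
  case: nS => n S /=; have [Sg|nSg] := pselect (S (g n)); last first.
    by exists (g n) => _; split => //; right.
  have [finS|infS] := pselect (finite_set S); last by exists (g n).
  have [x [_ nSx]] := infinite_setN0 (infinite_setD Kinf finS).
  by exists x => _; split => //; left.
have [letter letterP] := choice ex_letter.
(* At the start any letters will do: the symbols of [G_ 0] contain none. *)
pose T := fix T n : set K := if n is m.+1 then
  let S := T m in let x := letter (m, S) in
  S `|` [set x * z | z in S] `|` [set z * x | z in S] `|` [set p * x * z | z in S]
  else ev p q (fun=> p) @` G_ 0.
exists (fun n => letter (n, T n)); set c := fun n => _.
suff evT n : ev p q c @` G_ n = T n.
  move=> n; rewrite evT; apply: (letterP (n, T n)) => /=.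
  by rewrite -evT; apply: finite_image; exact: G_finite.
elim: n => [|n IHn]; last by rewrite ev_image_ext IHn.
by apply/seteqP; split=> _ [_ [s _ <-] <-]; exists (base s) => //; exists s.
Qed.

End Letters.

(** * The isomorphism *)

Theorem theorem8 (K : magmaType) (hK : ARAGB K)
    (hcount : [set: K] #= [set: nat]) :
  exists f : {multiplicative K -> H}, bijective f.
Proof.
have Kinf : infinite_set [set: K].
  by rewrite (eq_finite_set hcount); exact: infinite_nat.
have [p _] := infinite_setN0 Kinf.
have [q [_ qp]] := infinite_setN0 (infinite_setD Kinf (finite_set1 p)).
have [g gsurj] : exists g : nat -> K, forall y, exists n, g n = y.
  have /card_set_bijP[i] := hcount.
  rewrite setTT_bijective => -[g iK _].
  by exists g => y; exists (i y).
have [c cP] := exhausting_letters p q g Kinf.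
have newc n : ~ (ev p q c @` G_ n) (c n) by case: (cP n).
pose F (u : H) := ev p q c (val u).
have FM u v : F (u * v)%g = (F u * F v)%g.
  by apply: (ev_mul hK); apply: G_level; [exact: leq_maxl | exact: leq_maxr].
have Finj : injective F.
  move=> u v e; apply: val_inj.
  apply: (ev_inj hK _ _ _ (maxn (level u) (level v)) _ _ _ _ _ _ e) => //.
  - by move=> pq; apply: qp.
  - by apply: G_level; exact: leq_maxl.
  - by apply: G_level; exact: leq_maxr.
have Fsurj y : exists u, F u = y.
  have [n <-] := gsurj y.
  suff [s Gs <-] : (ev p q c @` G_ n.+1) (g n).
    have Hs : s \in \bigcup_n G_ n by apply/mem_set; exists n.+1.
    by exists (exist _ s Hs).
  have [_ [[s Gs <-]|<-]] := cP n; first by exists s => //; apply: G_le Gs.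
  (* The letter itself is not a symbol; its image is the value of [(a x) a]. *)
  exists (axl n (base ga)); last exact: (mulKr hK).
  by right; exists (base ga) => //; apply: (G_le (leq0n n)); exists ga.
have [f fP] := choice Fsurj.
have fK : cancel F f by move=> u; apply: Finj; rewrite fP.
have fM (x y : K) : f (x * y)%g = (f x * f y)%g.
  by apply: Finj; rewrite FM !fP.
pose m := isMultiplicative.Build K H f fM.
exists (HB.pack_for {multiplicative K -> H} f m).
by exists F.
Qed.
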